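(* For every $k\in\mathbb{N}$ there exist an infinite connected graph $H$ with finite metric dimension and nonadjacent distinct vertices $u,v$ of $H$ such that $\beta(H+uv)-\beta(H)>k$.
   Context: $\mathbb{N}$ denotes the nonnegative integers. Graphs are simple. For a connected graph $G$, finite or infinite, $d(u,v)$ is the number of edges of a shortest $u$--$v$ path. A vertex $w$ resolves $u,v$ if $d(u,w)\ne d(v,w)$; a set $W\subseteq V(G)$ is a resolving set if every two distinct vertices of $G$ are resolved by some $w\in W$. The metric dimension $\beta(G)$ is the minimum cardinality of a resolving set. $H+uv$ is $H$ with the edge $uv$ added. (It is known that adding a single edge to a connected graph of finite metric dimension leaves the metric dimension finite, so the difference is a difference of integers.) *)

(* Defs.v *)
From mathcomp Require Import all_boot all_order all_algebra.
From mathcomp Require Import boolp classical_sets functions cardinality.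

Set Implicit Arguments.
Unset Strict Implicit.
Unset Printing Implicit Defensive.

Local Open Scope classical_set_scope.
Local Open Scope card_scope.

Record graph := Graph {
  vertex :> Type;
  adj : vertex -> vertex -> Prop;
  adj_sym : forall x y, adj x y -> adj y x;
  adj_irrefl : forall x, ~ adj x x
}.

Section Metric.
Variable G : graph.

(* Only the values p 0, ..., p n matter; [set_inj] makes these n.+1 vertices
   pairwise distinct. *)
Definition path_of_length (x y : G) (n : nat) : Prop :=
  exists p : nat -> G,
    [/\ p 0 = x, p n = y,
        forall i, i < n -> adj (p i) (p i.+1) & set_inj `I_n.+1 p].

Definition connected : Prop := forall x y : G, exists n, path_of_length x y n.

Definition is_least (A : set nat) (n : nat) : Prop :=
  A n /\ forall m, A m -> n <= m.

(* The value is 0 when A is empty. *)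
Definition least (A : set nat) : nat := xget 0 [set n | is_least A n].

Definition dist (x y : G) : nat := least [set n | path_of_length x y n].

Definition resolves (w x y : G) : Prop := dist x w <> dist y w.

Definition resolving_set (W : set G) : Prop :=
  forall x y : G, x <> y -> exists2 w, W w & resolves w x y.

Definition finite_metric_dim : Prop :=
  exists2 W : set G, finite_set W & resolving_set W.

(* Meaningful only when [finite_metric_dim] holds; 0 otherwise. *)
Definition metric_dim : nat :=
  least [set n | exists2 W : set G, resolving_set W & W #= `I_n].

End Metric.

Section AddEdge.
Variables (H : graph) (u v : H) (neq_uv : u <> v).

Definition add_edge_adj (x y : H) : Prop :=
  [\/ adj x y, x = u /\ y = v | x = v /\ y = u].

Lemma add_edge_sym x y : add_edge_adj x y -> add_edge_adj y x.
Proof.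
case=> [xy|[-> ->]|[-> ->]].
- exact/Or31/adj_sym.
- exact: Or33.
- exact: Or32.
Qed.

Lemma add_edge_irrefl x : ~ add_edge_adj x x.
Proof.
case=> [|[xu xv]|[xv xu]]; first exact: adj_irrefl.
- by apply: neq_uv; rewrite -xu -xv.
- by apply: neq_uv; rewrite -xu -xv.
Qed.

Definition add_edge : graph := Graph add_edge_sym add_edge_irrefl.

End AddEdge.

(* Main.v *)
(** H consists of n+1 infinite vertical rays, joined horizontally at the levels
    0 and c, with c > 2n+2. The two ends of the bottom level resolve H, because
    the distances to them determine both coordinates. The edge added between
    (0, 0) and (0, c) brings every vertex of level 0 closer to level c than the
    segment of its ray between the two levels does. Hence, for each i, a shortest
    path from (i, c-1) or (i, c+1) to a vertex outside the ray i passes through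
    (i, c), the midpoint of the pair: only vertices of the ray i resolve this
    pair, and a resolving set meets every ray. *)

Require Import Defs.
From mathcomp Require Import all_boot all_order all_algebra.
From mathcomp Require Import boolp classical_sets functions cardinality.
From mathcomp Require Import zify.

Set Implicit Arguments.
Unset Strict Implicit.
Unset Printing Implicit Defensive.

Local Open Scope classical_set_scope.
Local Open Scope card_scope.

Lemma leastP (A : set nat) : A !=set0 -> is_least A (least A).
Proof.
move=> [a Aa]; rewrite /least; case: xgetP => [n _ //|noleast].
have exA : exists n, `[<A n>] by exists a; apply/asboolP.
case: (ex_minnP exA) => m /asboolP Am minm.
by case: (noleast m); split=> // j Aj; apply/minm/asboolP.
Qed.

Lemma least_leq (A : set nat) n : A n -> least A <= n.
Proof. by move=> An; have [_] := leastP (ex_intro _ n An); apply. Qed.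

(** * Paths and distances in a connected graph *)

Section Dist.
Variable G : graph.
Implicit Types x y w : G.

Lemma path_of_length0 x : path_of_length x x 0.
Proof. by exists (fun=> x); split=> // -[|i] [|j]; rewrite !inE. Qed.

(** Paths may not repeat vertices: if [x] already lies on the path, only its tail from [x] is kept,
    whence a bound on the length instead of an equality. *)
Lemma path_of_length_cons x y w n : adj x y -> path_of_length y w n ->
  exists2 m, m <= n.+1 & path_of_length x w m.
Proof.
move=> xy [p [p0 pn adjp injp]].
have inj i j : i <= n -> j <= n -> p i = p j -> i = j.
  by move=> ? ?; apply: injp; rewrite inE /= ltnS.
have [[j jn pj]|xp] := pselect (exists2 j, j <= n & p j = x).
  exists (n - j); first lia.
  exists (fun i => p (i + j)); split=> //.
  - by rewrite subnK.
  - by move=> i ij; rewrite addSn; apply: adjp; lia.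
  - move=> a b; rewrite !inE /= => ? ? /inj ab.
    by have := ab ltac:(lia) ltac:(lia); lia.
exists n.+1 => //; exists (fun i => if i is i'.+1 then p i' else x).
split=> //.
  by case=> [_|i ?]; [rewrite p0|apply: adjp].
case=> [|a] [|b]; rewrite !inE //= ?ltnS => an bn e.
- by case: xp; exists b; first lia.
- by case: xp; exists a; first lia.
- by congr _.+1; apply: inj e; lia.
Qed.

Lemma connected_ind :
    (forall (P : G -> Prop) x, P x ->
       (forall y z, adj y z -> P y -> P z) -> forall y, P y) ->
  connected G.
Proof.
move=> ind x y; apply: (ind (fun x => exists n, path_of_length x y n) y).
  by exists 0; exact: path_of_length0.
move=> a b /adj_sym ba [n pn]; have [m _ pm] := path_of_length_cons ba pn.
by exists m.
Qed.

Lemma dist_id x : dist x x = 0.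
Proof. by apply/eqP; rewrite -leqn0 least_leq //; exact: path_of_length0. Qed.

Hypothesis connG : connected G.

Lemma dist_path x y : path_of_length x y (dist x y).
Proof. by have [] := leastP (connG x y). Qed.

Lemma dist_adj x y w : adj x y -> dist x w <= (dist y w).+1.
Proof.
move=> /path_of_length_cons /(_ (dist_path y w)) [m mle pm].
by apply: leq_trans mle; exact: least_leq.
Qed.

Lemma dist_descent x w : x <> w -> exists2 y, adj x y & dist y w < dist x w.
Proof.
have [p [p0 pn adjp injp]] := dist_path x w; move: pn adjp injp.
case E: (dist x w) => [|n] pn adjp injp xw; first by rewrite -p0 in xw.
exists (p 1); first by rewrite -{1}p0; exact: adjp.
rewrite ltnS; apply: least_leq; exists (p \o succn); split=> //=.
- by move=> i ilt; apply: adjp.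
- move=> a b; rewrite !inE /= => an bn /injp ab.
  by apply/succn_inj/ab; rewrite inE.
Qed.

Lemma dist_gt0 x y : x <> y -> 0 < dist x y.
Proof. by move=> /dist_descent [z _]; lia. Qed.

(** A function that is 0 at [w] and grows by at most one per edge lies below any function that can
    always descend outside [w]. Both [f] and the distance to [w] are of both kinds. *)
Lemma dist_unique w (f : G -> nat) :
    f w = 0 -> (forall x y, adj x y -> f x <= (f y).+1) ->
    (forall x, x <> w -> exists2 y, adj x y & f y < f x) ->
  forall x, dist x w = f x.
Proof.
move=> fw lipf descf.
have le (g h : G -> nat) : g w = 0 ->
    (forall x y, adj x y -> g x <= (g y).+1) ->
    (forall x, x <> w -> exists2 y, adj x y & h y < h x) ->
    forall x, g x <= h x.
  move=> gw lipg desch x; have [m hm] := ubnP (h x).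
  elim: m => // m IH in x hm *.
  have [->|xw] := pselect (x = w); first by rewrite gw.
  have [y xy hy] := desch x xw.
  apply: leq_trans (lipg _ _ xy) (leq_ltn_trans _ hy); apply: IH; lia.
move=> x; apply/eqP; rewrite eqn_leq; apply/andP; split.
  apply: (le (fun x => dist x w)) => //; first exact: dist_id.
  by move=> ? ? /dist_adj.
by apply: (le f (fun x => dist x w)) => // y /dist_descent.
Qed.

End Dist.

(** * Bounds on the metric dimension *)

Lemma metric_dim_leq (G : graph) (W : set G) m :
  resolving_set W -> W #<= `I_m -> metric_dim G <= m.
Proof.
move=> resW Wm; have /finite_setP[j Wj] := card_le_finite Wm (finite_II m).
apply: (@leq_trans j); first by apply: least_leq; exists W.
by rewrite -card_le_II -(card_le_eql Wj).
Qed.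

(** Finiteness excludes the default value 0 of [least]. *)
Lemma metric_dim_geq (G : graph) m : finite_metric_dim G ->
  (forall W : set G, resolving_set W -> `I_m #<= W) -> m <= metric_dim G.
Proof.
move=> [W /finite_setP[j Wj] resW] lb.
have /leastP[[V resV Vd] _] :
    [set d | exists2 V : set G, resolving_set V & V #= `I_d] !=set0.
  by exists j, W.
by have := lb V resV; rewrite (card_le_eqr Vd) card_le_II.
Qed.

(* The only way to keep descending along a ray without descending to its origin
   is forever. *)
Lemma ray_descent (D : nat -> nat) :
    (forall m, D m.+1 <= (D m).+1) ->
    (forall m, D m < D m.+1 \/ D m.+2 < D m.+1) ->
  forall m, D m = D 0 + m.
Proof.
move=> lip desc.
have inc m : D m < D m.+1.
  have [b Db] := ubnP (D m.+1); elim: b => // b IH in m Db *.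
  by have [//|lt] := desc m; have := IH m.+1 ltac:(lia); lia.
by elim=> [|m IH]; [lia|have := inc m; have := lip m; lia].
Qed.

(** The last hypothesis forbids descending from [m] to [m.+1], so the descent from [m] goes to
    [m.-1]; the same then holds at each level below, as far as 0. *)
Lemma segment_descent (D : nat -> nat) m :
    (forall h, h < m -> D h < D h.+1 \/ D h.+2 < D h.+1) ->
  D m <= D m.+1 -> D 0 + m <= D m.
Proof.
elim: m => [|m IH] desc le; first by rewrite addn0.
have [lt|] := desc m (leqnn _); last lia.
have := IH (fun h hm => desc h (leqW hm)) (ltnW lt); lia.
Qed.

(** * The comb and its metric dimension *)

Section Comb.
Variables n c : nat.

Definition comb_adj (a b : 'I_n.+1 * nat) : Prop :=
  (a.1 = b.1 /\ (a.2 = b.2.+1 \/ b.2 = a.2.+1)) \/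
  [/\ a.2 = b.2, a.2 = 0 \/ a.2 = c &
      a.1 = b.1.+1 :> nat \/ b.1 = a.1.+1 :> nat].

Lemma comb_sym a b : comb_adj a b -> comb_adj b a.
Proof.
case=> [[e /or_comm]|[e lev /or_comm]]; first by left.
by right; split=> //; rewrite -e.
Qed.

Lemma comb_irrefl a : ~ comb_adj a a.
Proof. by case=> [[_]|[_ _]]; lia. Qed.

Definition comb : graph := Graph comb_sym comb_irrefl.

Lemma comb_adj_up (i : 'I_n.+1) h : comb_adj (i, h) (i, h.+1).
Proof. by left; split=> //=; right. Qed.

(** By symmetry of adjacency, [P] has the same truth value at both ends of an edge, hence at any
    vertex and at the origin: go down the ray, then along level 0. *)
Lemma comb_ind (P : comb -> Prop) (x : comb) : P x ->
  (forall y z : comb, adj y z -> P y -> P z) -> forall y, P y.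
Proof.
move=> Px stepP.
have down (i : 'I_n.+1) h : P (i, h) <-> P (i, 0).
  elim: h => // h <-.
  by split; apply: stepP; [apply: comb_sym|]; exact: comb_adj_up.
have left0 (i : 'I_n.+1) : P (i, 0) <-> P (ord0, 0).
  case: i; elim=> [|j IH] jn.
    by rewrite (_ : Ordinal jn = ord0) //; apply: val_inj.
  rewrite -(IH (ltnW jn)).
  by split; apply: stepP; right; split=> //=; lia.
case: x Px => i h Px [j l].
by rewrite down left0 -(left0 i) -(down i h).
Qed.

Lemma comb_connected : connected comb.
Proof. exact: connected_ind comb_ind. Qed.

Lemma infinite_comb : infinite_set [set: comb].
Proof.
move=> fin; apply: infinite_nat.
have := finite_image snd fin; congr finite_set.
by apply/seteqP; split=> // h _; exists (ord0, h).
Qed.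

(** Level [c] gives no shortcut, since every edge changes exactly one coordinate, by one. *)
Lemma dist_comb_first (x : comb) : dist x (ord0, 0) = x.1 + x.2.
Proof.
apply: (dist_unique comb_connected (f := fun x : comb => x.1 + x.2)) => //.
  move=> [i h] [j l] /=.
  by case=> /= [[-> ?]|[-> _ ?]]; lia.
move=> [i [|h]] /= ne; last first.
  by exists (i, h); [apply: comb_sym; exact: comb_adj_up|rewrite /=; lia].
case: i ne => [[|j]] jn ne.
  by case: ne; congr pair; apply: val_inj.
exists (Ordinal (ltnW jn), 0); last by rewrite /=; lia.
by right; split=> /=; lia.
Qed.

Lemma dist_comb_last (x : comb) : dist x (ord_max, 0) = n - x.1 + x.2.
Proof.
apply: (dist_unique comb_connected (f := fun x : comb => n - x.1 + x.2)) => //.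
- by rewrite /= subnn.
- move=> [i h] [j l] /=.
  by case=> /= [[-> ?]|[-> _ ?]]; lia.
move=> [i [|h]] /= ne; last first.
  by exists (i, h); [apply: comb_sym; exact: comb_adj_up|rewrite /=; lia].
have [ilt|ige] := ltnP i n; last first.
  by case: ne; congr pair; apply: val_inj => /=; have := ltn_ord i; lia.
have iS : i.+1 < n.+1 by [].
exists (Ordinal iS, 0); last by rewrite /=; lia.
by right; split=> /=; lia.
Qed.

Lemma comb_resolving : resolving_set [set ((ord0, 0) : comb); (ord_max, 0)].
Proof.
move=> [i h] [j l] ne.
have [e1|] := pselect (i + h = j + l); last first.
  by exists (ord0, 0); [left|rewrite /resolves !dist_comb_first].
exists (ord_max, 0); first by right.
rewrite /resolves !dist_comb_last /= => e2; apply: ne.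
(* The bounds make the truncated differences [n - i] and [n - j] exact; adding both equations gives
   [h = l], then [i = j]. *)
have := ltn_ord i; have := ltn_ord j => ? ?.
by congr pair; [apply: val_inj => /=|]; lia.
Qed.

Lemma comb_finite_metric_dim : finite_metric_dim comb.
Proof. by eexists; last exact: comb_resolving. Qed.

Lemma metric_dim_comb : metric_dim comb <= 2.
Proof.
apply: metric_dim_leq comb_resolving _.
pose f i : comb := if i is 0 then (ord0, 0) else (ord_max, 0).
apply: card_le_trans (card_image_le f `I_2); apply: subset_card_le => x [] ->.
- by exists 0.
- by exists 1.
Qed.

(** * The comb with the added edge *)

Hypothesis c_gt0 : 0 < c.

Let u : comb := (ord0, 0).
Let v : comb := (ord0, c).

Lemma ends_neq : u <> v.
Proof. by case; lia. Qed.

Lemma ends_nadj : 1 < c -> ~ adj u v.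
Proof. by move=> c1; case=> /= [[_]|[]]; lia. Qed.

Definition shortcut_comb : graph := add_edge ends_neq.
Let G := shortcut_comb.

Lemma shortcut_connected : connected G.
Proof.
apply: connected_ind => P x Px stepP; apply: comb_ind Px _ => y z yz.
by apply: stepP; exact: Or31.
Qed.

Lemma dist_up (w : G) (i : 'I_n.+1) h :
  dist ((i, h.+1) : G) w <= (dist ((i, h) : G) w).+1.
Proof.
by apply: (dist_adj shortcut_connected); apply/Or31/comb_sym/comb_adj_up.
Qed.

Lemma dist_down (w : G) (i : 'I_n.+1) h :
  dist ((i, h) : G) w <= (dist ((i, h.+1) : G) w).+1.
Proof. by apply: (dist_adj shortcut_connected); apply/Or31/comb_adj_up. Qed.

(** All horizontal edges, and both ends of the new one, are at levels 0 and [c]; elsewhere the only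
    neighbours are vertical. *)
Lemma vertical_descent (w : G) (i : 'I_n.+1) h : h.+1 <> c -> (i, h.+1) <> w ->
  let D h := dist ((i, h) : G) w in D h < D h.+1 \/ D h.+2 < D h.+1.
Proof.
move=> hc /(dist_descent shortcut_connected)[[j l] adjl lt] D.
suff [ji [lh|lh]] : j = i /\ (l = h \/ l = h.+2).
- by left; rewrite ji lh in lt.
- by right; rewrite ji lh in lt.
case: adjl => [[] /=|[[]]|[[]]] //.
  by move=> [-> ?]; split=> //; lia.
by move=> [_ ?]; lia.
Qed.

Lemma dist_above (w : G) (i : 'I_n.+1) m : w.1 <> i \/ w.2 <= c ->
  dist ((i, c + m) : G) w = dist ((i, c) : G) w + m.
Proof.
move=> wi; rewrite (ray_descent (D := fun m => dist ((i, c + m) : G) w)).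
- by rewrite addn0.
- by move=> l; rewrite addnS; exact: dist_up.
- move=> l; rewrite !addnS; apply: vertical_descent; first lia.
  by move=> e; move: wi; rewrite -e /=; case=> //; lia.
Qed.

(* Follow level 0 to the ray 0, cross the new edge, and come back along level c. *)
Lemma dist_level_c (w : G) (i : 'I_n.+1) :
  dist ((i, c) : G) w <= dist ((i, 0) : G) w + i.*2.+1.
Proof.
case: i; elim=> [|j IH] jn.
  rewrite addn1; apply: (dist_adj shortcut_connected); apply: Or33.
  by split; congr pair; apply: val_inj.
have jn' := ltnW jn.
have e1 : dist ((Ordinal jn, c) : G) w <= (dist ((Ordinal jn', c) : G) w).+1.
  apply: (dist_adj shortcut_connected); apply: Or31; right.
  by split=> //=; lia.
have e2 : dist ((Ordinal jn', 0) : G) w <= (dist ((Ordinal jn, 0) : G) w).+1.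
  apply: (dist_adj shortcut_connected); apply: Or31; right.
  by split=> //=; lia.
by have := IH jn' => /=; lia.
Qed.

(** Otherwise the distance does not decrease from level [c.-1] to [c], so a shortest path descends
    to level 0 in [c.-1] steps. The detour by the new edge shows that [c.-1] is at most [i.*2.+1],
    hence at most [n.*2.+1], against the choice of [c]. *)
Lemma dist_below (w : G) (i : 'I_n.+1) : n.*2.+2 < c ->
    w.1 <> i \/ w.2 = 0 \/ c <= w.2 ->
  dist ((i, c.-1) : G) w = (dist ((i, c) : G) w).+1.
Proof.
move=> cn wi; have cE : c.-1.+1 = c by lia.
have := dist_down w i c.-1; rewrite cE leq_eqVlt => /orP[/eqP //|].
rewrite ltnS => le.
have desc h : h < c.-1 ->
    let D h := dist ((i, h) : G) w in D h < D h.+1 \/ D h.+2 < D h.+1.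
  move=> hc; apply: vertical_descent; first lia.
  by move=> e; move: wi; rewrite -e /=; case=> //; lia.
have := segment_descent desc; rewrite cE => /(_ le).
have := dist_level_c w i; have := ltn_ord i; lia.
Qed.

Lemma shortcut_resolves (w : G) (i : 'I_n.+1) : n.*2.+2 < c ->
  resolves w ((i, c.-1) : G) ((i, c.+1) : G) -> w.1 = i.
Proof.
move=> cn res; apply: contrapT => wi; apply: res.
have wi' : w.1 <> i \/ w.2 <= c by left.
by rewrite -(addn1 c) dist_above // addn1 dist_below //; left.
Qed.

(** The vertices up to level [c] resolve the graph: each resolves itself from any other, and higher
    vertices are measured through level [c]. *)
Lemma shortcut_finite_metric_dim : finite_metric_dim G.
Proof.
pose f (p : 'I_n.+1 * 'I_c.+1) : G := (p.1, val p.2).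
exists [set f p | p in [set: _]].
  by apply: finite_image; exact: finite_finset.
have Wf (i : 'I_n.+1) h : h <= c -> (range f) (i, h).
  by rewrite -ltnS => hc; exists (i, Ordinal hc).
have own (x y : G) : x <> y -> resolves x x y.
  move=> /nesym /(dist_gt0 shortcut_connected) yx; rewrite /resolves dist_id.
  by lia.
move=> [i h] [j l] ne.
have [hc|ch] := leqP h c; first by exists (i, h); [exact: Wf|exact: own].
have [lc|cl] := leqP l c.
  by exists (j, l); [exact: Wf|apply/nesym/own/nesym].
have above (a b : 'I_n.+1) m : c < m ->
    dist ((a, m) : G) (b, c) = dist ((a, c) : G) (b, c) + (m - c).
  by move=> cm; rewrite -{1}(subnKC (ltnW cm)) dist_above //; right.
have [ij|ij] := eqVneq i j.
  exists (i, c); first exact: Wf.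
  rewrite /resolves (above _ _ h) // (above _ _ l) // -ij => e; apply: ne.
  by rewrite -ij; congr pair; lia.
have gt0 (a b : 'I_n.+1) : a != b -> 0 < dist ((a, c) : G) (b, c).
  by move=> /eqP ab; apply: (dist_gt0 shortcut_connected) => -[].
(* If neither [(i, c)] nor [(j, c)] resolved the pair, [h] would exceed [l] and [l] would exceed
   [h]. *)
have [e|] := pselect (dist ((i, h) : G) (i, c) = dist ((j, l) : G) (i, c)).
  exists (j, c); first exact: Wf.
  rewrite /resolves; move: e.
  rewrite !(above _ _ h) // !(above _ _ l) // !dist_id.
  have := gt0 i j ij; rewrite eq_sym in ij; have := gt0 j i ij; lia.
by exists (i, c); first exact: Wf.
Qed.

Lemma metric_dim_shortcut : n.*2.+2 < c -> n < metric_dim G.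
Proof.
move=> cn; apply: metric_dim_geq shortcut_finite_metric_dim _ => W resW.
(* The ray index maps [W] onto all [n.+1] indices. *)
apply: card_le_trans (card_image_le (fun x : G => val x.1) W).
apply: subset_card_le => i /= ilt.
have [|w Ww /(shortcut_resolves cn) wi] :=
    resW (Ordinal ilt, c.-1) (Ordinal ilt, c.+1).
  by case; lia.
by exists w => //; rewrite wi.
Qed.

End Comb.

Theorem corollary4p6 (k : nat) :
  exists (H : graph) (u v : H) (neq_uv : u <> v),
    [/\ infinite_set [set: H],
        connected H,
        finite_metric_dim H,
        ~ adj u v &
        finite_metric_dim (add_edge neq_uv) /\
        (k%:Z < (metric_dim (add_edge neq_uv))%:Z - (metric_dim H)%:Z)%R].
Proof.
(* The dimension is at most 2 before and at least [n.+1], that is [k + 3], after the addition; [c]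
   is the least value allowed. *)
pose n := k.+2; pose c := n.*2.+3; have c0 : 0 < c by [].
exists (comb n c), (ord0, 0), (ord0, c), (@ends_neq n c c0); split.
- exact: infinite_comb.
- exact: comb_connected.
- exact: comb_finite_metric_dim.
- exact: ends_nadj.
- split; first exact: shortcut_finite_metric_dim.
  have := @metric_dim_shortcut n c c0 (leqnn _).
  have := metric_dim_comb n c; rewrite /shortcut_comb /n.
  by lia.
Qed.
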